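(* Let $R$ be a Greek ring. Put $\pi=\sum_{d\geq 1}(-1)^{d+1}t^d\in L(\mathbb{Z})$. Then the Pfister elements of $R$ are exactly the elements $x\in R$ such that $x^2=2x$ and $x$ has $\pi$-dimension at most $1$. Moreover, the Pfister elements of $R$ are exactly the elements of the form $1-a$ where $a\in R$ has $\lambda$-dimension $1$ and satisfies $a^2=1$.
   Context: For a commutative ring $R$ let $G(R)=1+tR[[t]]$ (a group under multiplication of power series) and $L(R)=t+t^2R[[t]]$ (a group under composition of power series). A Greek operation on $R$ is a sequence of maps $\alpha^d:R\to R$ ($d\geq 0$) with $\alpha^0(x)=1$, $\alpha^1(x)=x$ and $\alpha^d(x+y)=\sum_{k=0}^d\alpha^k(x)\alpha^{d-k}(y)$. Write $\alpha_t(x)=\sum_d\alpha^d(x)t^d\in G(R)$. Its Greek letter is $\alpha_t(1)-1\in L(R)$. The group $L(R)$ acts freely on the right on the set of Greek operations by $(\alpha_t\cdot\tau)(x)=\alpha_{\tau(t)}(x)$ (substitution of $\tau(t)$ for $t$ in $\alpha_t(x)$). A Greek ring is a commutative ring $R$ with a chosen $L(R)$-orbit of Greek operations; for each $\alpha\in L(R)$ there is a unique operation in the orbit with Greek letter $\alpha$, denoted $(\alpha^d)_d$ or $\alpha_t$. The letter $\lambda$ denotes $t\in L(\mathbb{Z})$, so $\lambda^d(1)=0$ for $d\geq 2$, and for any letter $\alpha$ one has $\alpha_t(x)=\lambda_{\alpha(t)}(x)$ (so a Greek ring is the same as what is usually called a pre-$\lambda$-ring). Letters in $L(\mathbb{Z})$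 are mapped to $L(R)$ via $\mathbb{Z}\to R$. The $\alpha$-dimension of $x\in R$ is the degree in $t$ (possibly infinite) of $\alpha_t(x)$. An element $x\in R$ is a Pfister element if $x^2=2x$ and $\lambda^d(x)=x$ for all $d\geq 1$.
   Formalization: The second claim (Pfister elements are the 1 − a with a of λ-dimension 1 and a² = 1) is stated only for R with 1 ≠ 0; in the zero ring 0 is a Pfister element but no element has λ-dimension exactly 1. *)

(* Defs.v *)
From HB Require Import structures.
From mathcomp Require Import all_boot all_algebra.
From mathcomp Require Import boolp classical_sets.

Set Implicit Arguments.
Unset Strict Implicit.
Unset Printing Implicit Defensive.

Import GRing.Theory.
Local Open Scope ring_scope.
Local Open Scope classical_set_scope.

(* [comPzRingType] is the class of all commutative unital rings, the zero ring
   included. *)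

(* The power series sum_n (f n) t^n is encoded by its coefficients. *)
Definition pseries (R : Type) := nat -> R.

Section PowerSeries.
Variable R : comPzRingType.
Implicit Types f g : pseries R.

Definition psone : pseries R := fun n => (n == 0%N)%:R.

Definition psmul f g : pseries R :=
  fun n => \sum_(i < n.+1) f i * g (n - i)%N.

Definition psexp f (k : nat) : pseries R := iter k (psmul f) psone.

(* f(g(t)), only meaningful when g has zero constant term: then g^k has no
   coefficient in degrees below k, and the sum may be stopped at k = n. *)
Definition pscomp f g : pseries R :=
  fun n => \sum_(k < n.+1) f k * psexp g k n.

(* degree f <= n, resp. degree f = n; neither holds of a series of infinite
   degree *)
Definition psdeg_le f (n : nat) := forall d, (n < d)%N -> f d = 0.
Definition psdeg_eq f (n : nat) := f n <> 0 /\ psdeg_le f n.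

End PowerSeries.

Arguments psexp : simpl never.

(* L(R) = t + t^2 R[[t]] *)
Record letter (R : comPzRingType) := Letter {
  letter_val :> pseries R;
  letter_val0 : letter_val 0%N = 0;
  letter_val1 : letter_val 1%N = 1 }.

Section GreekOperations.
Variable R : comPzRingType.
Implicit Types (a : nat -> R -> R) (tau : letter R).

Definition is_greek_operation a :=
  [/\ forall x, a 0%N x = 1,
      forall x, a 1%N x = x
    & forall d x y, a d (x + y) = \sum_(k < d.+1) a k x * a (d - k)%N y].

Definition op_series a (x : R) : pseries R := fun d => a d x.

Definition op_letter a : pseries R := fun d => op_series a 1 d - psone R d.

Definition op_act a tau : nat -> R -> R :=
  fun d x => pscomp (op_series a x) tau d.

Definition op_orbit a : set (nat -> R -> R) := [set op_act a tau | tau in setT].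

End GreekOperations.

Record greekRing := GreekRing {
  greek_sort :> comPzRingType;
  greek_orbit : set (nat -> greek_sort -> greek_sort);
  greek_orbitP : exists a, is_greek_operation a /\ greek_orbit = op_orbit a }.

Arguments greek_orbit : clear implicits.

Section LetterEquation.
Variable R : comPzRingType.
Implicit Types f g : pseries R.

Lemma psexpS f k n :
  psexp f k.+1 n = \sum_(i < n.+1) f i * psexp f k (n - i)%N.
Proof. by []. Qed.

Lemma psexp0 f k : f 0%N = 0 -> psexp f k.+1 0%N = 0.
Proof. by move=> f0; rewrite /psexp iterS /psmul big_ord1 f0 mul0r. Qed.

Lemma psexp_eq_prefix f g n k :
  (forall i, (i <= n)%N -> f i = g i) ->
  forall i, (i <= n)%N -> psexp f k i = psexp g k i.
Proof.
move=> fg; elim: k => [//|k IH] i le_in.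
rewrite /psexp !iterS /psmul; apply: eq_bigr => j _.
have le_ji : (j <= i)%N by rewrite -ltnS.
rewrite fg ?(leq_trans le_ji) //; congr (_ * _).
by apply: IH; rewrite (leq_trans (leq_subr _ _)).
Qed.

Lemma psexp_eq_strict f g n k : f 0%N = 0 -> g 0%N = 0 ->
  (forall i, (i < n)%N -> f i = g i) -> psexp f k.+2 n = psexp g k.+2 n.
Proof.
move=> f0 g0; case: n => [_|n fg]; first by rewrite !psexp0.
rewrite (psexpS f k.+1) (psexpS g k.+1); apply: eq_bigr => -[[|i] /= lt_i] _.
  by rewrite f0 g0 !mul0r.
have [->|ne_in] := eqVneq i n; first by rewrite subSS subnn !psexp0 ?mulr0.
rewrite ltnS ltnS in lt_i.
have lt_in : (i < n)%N by rewrite ltn_neqAle ne_in lt_i.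
rewrite fg ?ltnS //; congr (_ * _).
by apply: (@psexp_eq_prefix _ _ n); rewrite ?subSS ?leq_subr.
Qed.

Lemma psexp1 f : psexp f 1 =1 f.
Proof.
move=> n; rewrite /psexp /= /psmul big_ord_recr /= subnn /psone eqxx mulr1.
rewrite big1 ?add0r // => i _.
by rewrite subn_eq0 leqNgt ltn_ord mulr0.
Qed.

Definition pscomp_high b f n : R := \sum_(k < n) b k.+2 * psexp f k.+2 n.+1.

Lemma pscompS b f n : b 1%N = 1 ->
  pscomp b f n.+1 = f n.+1 + pscomp_high b f n.
Proof.
move=> b1; rewrite /pscomp !big_ord_recl /= /psexp /= /psone mulr0 add0r.
by rewrite -[psmul f _ _]/(psexp f 1 n.+1) psexp1 b1 mul1r.
Qed.

Lemma pscomp_high_eq b f g n : f 0%N = 0 -> g 0%N = 0 ->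
  (forall i, (i <= n)%N -> f i = g i) -> pscomp_high b f n = pscomp_high b g n.
Proof.
move=> f0 g0 fg; apply: eq_bigr => k _; congr (_ * _).
exact: psexp_eq_strict.
Qed.

Lemma pscomp_inj b f g : b 1%N = 1 -> f 0%N = 0 -> g 0%N = 0 ->
  pscomp b f = pscomp b g -> f = g.
Proof.
move=> b1 f0 g0 e; apply/funext => n.
elim/ltn_ind: n => -[|n] IH; first by rewrite f0 g0.
have := congr1 (fun h => h n.+1) e; rewrite !pscompS //.
by rewrite (@pscomp_high_eq b f g n) // => /addIr.
Qed.

Lemma pscomp_surj b (a : letter R) : b 0%N = 0 -> b 1%N = 1 ->
  exists tau : letter R, pscomp b tau = a.
Proof.
move=> b0 b1.
pose fix T (m : nat) : pseries R := if m is m'.+1 then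
  fun n => if n == m'.+1 then letter_val a n - pscomp_high b (T m') m' else T m' n
  else fun=> 0.
have TS m n : T m.+1 n =
  if n == m.+1 then letter_val a n - pscomp_high b (T m) m else T m n by [].
have T0 m : T m 0%N = 0 by elim: m => //= m ->.
have Tstable m n : (n <= m)%N -> T m n = T n n.
  elim: m => [|m IH]; first by rewrite leqn0 => /eqP ->.
  rewrite leq_eqVlt ltnS => /predU1P[-> //|le_nm].
  by rewrite TS ltn_eqF ?ltnS // IH.
pose tau n := T n n.
have tauS n : tau n.+1 = letter_val a n.+1 - pscomp_high b tau n.
  rewrite /tau TS eqxx; congr (_ - _).
  by apply: pscomp_high_eq; rewrite ?T0 // => i le_in; apply: Tstable.
have tau1 : tau 1%N = 1 by rewrite tauS /pscomp_high big_ord0 subr0 letter_val1.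
exists (@Letter R tau (T0 0%N) tau1); apply/funext => -[|n] /=.
  by rewrite /pscomp big_ord1 b0 mul0r letter_val0.
by rewrite pscompS // tauS subrK.
Qed.

End LetterEquation.

Section GreekLetters.
Variable R : greekRing.

Lemma op_letter_act (a : nat -> R -> R) (tau : letter R) :
  (forall x, a 0%N x = 1) ->
  op_letter (op_act a tau) = pscomp (op_letter a) tau.
Proof.
move=> a0; apply/funext => n.
rewrite /op_letter /op_act /pscomp !big_ord_recl /= /op_series /psone /=.
rewrite big_ord_recl !a0 subrr mul0r add0r mul1r addrAC subrr add0r.
by apply: eq_bigr => i _; rewrite subr0.
Qed.

Lemma greek_op_exists (alpha : letter R) :
  exists a, greek_orbit R a /\ op_letter a = alpha.
Proof.
have [b [[b0 b1 _] ->]] := greek_orbitP R.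
have l0 : op_letter b 0%N = 0 by rewrite /op_letter /op_series b0 subrr.
have l1 : op_letter b 1%N = 1 by rewrite /op_letter /op_series b1 subr0.
have [tau e] := pscomp_surj alpha l0 l1.
exists (op_act b tau); split; first by exists tau.
by rewrite op_letter_act.
Qed.

Lemma greek_op_unique (a a' : nat -> R -> R) :
  greek_orbit R a -> greek_orbit R a' -> op_letter a = op_letter a' -> a = a'.
Proof.
have [b [[b0 b1 _] ->]] := greek_orbitP R.
move=> [tau _ <-] [tau' _ <-]; rewrite !op_letter_act // => e.
have l1 : op_letter b 1%N = 1 by rewrite /op_letter /op_series b1 subr0.
by rewrite /op_act (pscomp_inj l1 (letter_val0 _) (letter_val0 _) e).
Qed.

(* The operation of the chosen orbit with Greek letter alpha; the choice is
   immaterial by greek_op_unique. *)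
Definition greek_op (alpha : letter R) : nat -> R -> R :=
  sval (cid (greek_op_exists alpha)).

Lemma greek_op_orbit alpha : greek_orbit R (greek_op alpha).
Proof. by rewrite /greek_op; case: cid => a []. Qed.

Lemma greek_op_letter alpha : op_letter (greek_op alpha) = alpha.
Proof. by rewrite /greek_op; case: cid => a []. Qed.

End GreekLetters.

Section IntegralLetter.
Variables (R : comPzRingType) (alpha : letter int).

Definition letterz_val : pseries R := fun n => (letter_val alpha n)%:~R.

Lemma letterz_val0 : letterz_val 0%N = 0.
Proof. by rewrite /letterz_val letter_val0. Qed.

Lemma letterz_val1 : letterz_val 1%N = 1.
Proof. by rewrite /letterz_val letter_val1. Qed.

(* The image of alpha under L(Z) -> L(R). *)
Definition letterz : letter R := Letter letterz_val0 letterz_val1.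

End IntegralLetter.

(* the series t *)
Definition lambda_letter : letter int :=
  @Letter int (fun d => (d == 1%N)%:R) erefl erefl.

(* t / (1 + t) = t - t^2 + t^3 - ... *)
Definition pi_letter : letter int :=
  @Letter int (fun d => if d is 0%N then 0 else (-1) ^+ d.+1) erefl erefl.

Section Pfister.
Variable R : greekRing.

Definition zgreek_op (alpha : letter int) : nat -> R -> R :=
  greek_op (letterz R alpha).

Definition greek_dim_le (alpha : letter int) (x : R) (n : nat) :=
  psdeg_le (op_series (zgreek_op alpha) x) n.

Definition greek_dim_eq (alpha : letter int) (x : R) (n : nat) :=
  psdeg_eq (op_series (zgreek_op alpha) x) n.

Definition pfister (x : R) :=
  x ^+ 2 = 2%:R * x /\
  forall d, (1 <= d)%N -> zgreek_op lambda_letter d x = x.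

End Pfister.

(* Main.v *)
Require Import Defs.
From HB Require Import structures.
From mathcomp Require Import all_boot all_algebra.
From mathcomp Require Import boolp classical_sets.

Set Implicit Arguments.
Unset Strict Implicit.
Unset Printing Implicit Defensive.

Import GRing.Theory.
Local Open Scope ring_scope.

(** Put p(t) = t / (1 + t), the letter pi, so that pi_t(x) = lambda_{p(t)}(x).

    Degree criterion.  Given x ^ 2 = 2 x, being Pfister means that lambda_t(x)
    is the series 1 + x t / (1 - t).  Since p / (1 - p) = t, substituting p(t)
    for t turns this series into 1 + x t ([geometric_comp_pi]); and a series of
    the form 1 + x t + ... has degree at most 1 exactly when it is 1 + x t.  As
    the substitution of p is injective ([pscomp_injl]), lambda_t(x) is the
    geometric series iff pi_t(x) = 1 + x t.

    The identity pi_t(x) = lambda_{p(t)}(x) is [greek_op_comp]: the operations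
    with letters lambda and pi are only known as two elements of one orbit
    b . L(R), so it amounts to the statement that L(R) acts on the right.  This
    needs the associativity of substitution ([pscompA]), which follows from its
    multiplicativity ([pscompM]).  Multiplicativity also shows that all elements
    of the orbit satisfy the addition formula.

    Involutions.  If x + a = 1 then lambda_t(a) lambda_t(x) = 1 + t.  When
    x ^ 2 = 2 x, equivalently a ^ 2 = 1, a direct multiplication gives
    (1 + a t)(1 + x t / (1 - t)) = 1 + t.  Hence each of lambda_t(a) = 1 + a t
    and lambda_t(x) = 1 + x t / (1 - t) forces the other; both directions are
    inductions on the coefficient of t^d.  Finally a is nonzero because
    a ^ 2 = 1 is, so that its lambda-dimension is exactly 1. *)

(** * Substitution of power series *)

Section Substitution.
Variable R : comPzRingType.
Implicit Types (f g h u v w : pseries R).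

(** Summing products of series against a weight supported in degrees below N
    replaces the triangle k = i + j by a square of indices, on which sums can be
    exchanged freely: truncation is dealt with once, here. *)
Lemma psmul_weighted u v w (N : nat) :
  (forall s, (N <= s)%N -> w s = 0) ->
  \sum_(k < N) psmul u v k * w k =
  \sum_(i < N) \sum_(j < N) u i * v j * w (i + j)%N.
Proof.
move=> w0.
transitivity (\sum_(k < N) \sum_(i < N | (i < k.+1)%N) u i * v (k - i)%N * w k).
  apply: eq_bigr => k _; rewrite /psmul mulr_suml.
  by rewrite (big_ord_widen N (fun i => u i * v (k - i)%N * w k)).
rewrite (exchange_big_dep predT) //=; apply: eq_bigr => i _.
transitivity (\sum_(i <= k < N) u i * v (k - i)%N * w k).
  rewrite [RHS]big_nat_cond [RHS](big_nat_widenl _ 0) //= big_mkord.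
  by apply: eq_bigl => k; rewrite ltn_ord ltnS !andbT andbb.
rewrite -{1}[i : nat]add0n big_addn big_mkord.
rewrite (big_ord_widen N (fun j => u i * v (j + i - i)%N * w (j + i)%N)); last first.
  exact: leq_subr.
rewrite big_mkcond; apply: eq_bigr => j _; rewrite addnK addnC.
by case: ltnP => // le; rewrite w0 ?mulr0 -?leq_subLR.
Qed.

Lemma psmulA f g h : psmul f (psmul g h) = psmul (psmul f g) h.
Proof.
apply/funext => n.
(* w is the weight h_(n-s), cut off where the subtraction would truncate. *)
pose w s := if (s <= n)%N then h (n - s)%N else 0.
have wE s : (s <= n)%N -> h (n - s)%N = w s by rewrite /w => ->.
transitivity (\sum_(k < n.+1) psmul f g k * w k); last first.
  by apply: eq_bigr => k _; rewrite wE // -ltnS.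
rewrite psmul_weighted => [|s]; last by rewrite ltnNge /w => /negbTE ->.
apply: eq_bigr => i _; rewrite /psmul mulr_sumr.
have le_in : (i <= n)%N by rewrite -ltnS.
rewrite (big_ord_widen n.+1 (fun j => f i * (g j * h (n - i - j)%N))); last first.
  by rewrite ltnS leq_subr.
rewrite big_mkcond; apply: eq_bigr => j _.
by rewrite mulrA /w ltnS leq_subRL // subnDA; case: leqP => //; rewrite mulr0.
Qed.

Lemma psmul1f f : psmul (psone R) f = f.
Proof.
apply/funext => n; rewrite /psmul big_ord_recl /psone /= mul1r subn0.
by rewrite big1 ?addr0 // => i _; rewrite mul0r.
Qed.

Lemma psexpD h i j : psexp h (i + j) = psmul (psexp h i) (psexp h j).
Proof.
elim: i => [|i IH]; first by rewrite psmul1f.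
by rewrite addSn {1}/psexp iterS -/(psexp h (i + j)) IH psmulA.
Qed.

Lemma psexp_eq0 h k n : h 0%N = 0 -> (n < k)%N -> psexp h k n = 0.
Proof.
move=> h0; elim: k n => // k IH n lt_nk.
rewrite psexpS big1 // => -[[|i] /= lt_i] _; first by rewrite h0 mul0r.
rewrite IH ?mulr0 //; rewrite ltnS in lt_nk.
by case: n lt_i lt_nk => // n _; apply: leq_ltn_trans; rewrite subSS leq_subr.
Qed.

Lemma psexp_diag h n : h 0%N = 0 -> h 1%N = 1 -> psexp h n n = 1.
Proof.
move=> h0 h1; elim: n => // n IH.
rewrite psexpS !big_ord_recl /= h0 mul0r add0r h1 mul1r subn1 IH.
rewrite big1 ?addr0 // => i _; rewrite psexp_eq0 ?mulr0 //=.
by rewrite /bump /= !add1n subSS ltn_subrL /= (leq_ltn_trans _ (ltn_ord i)).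
Qed.

(** The sum defining a coefficient of f(h(t)) may be extended at will, since h^k
    has no terms below degree k. *)
Lemma pscomp_wide f h n N : h 0%N = 0 -> (n < N)%N ->
  pscomp f h n = \sum_(k < N) f k * psexp h k n.
Proof.
move=> h0 lt_nN; rewrite /pscomp (big_ord_widen N (fun k => f k * psexp h k n)) //.
rewrite big_mkcond; apply: eq_bigr => k _.
by case: ltnP => // lt_nk; rewrite psexp_eq0 ?mulr0.
Qed.

(** With the indices running over a square, both sides become the sum of
    u_i v_j [t^n] h^(i+j): on the left by [psmul_weighted], on the right
    by [psexpD]. *)
Lemma pscompM u v h : h 0%N = 0 ->
  pscomp (psmul u v) h = psmul (pscomp u h) (pscomp v h).
Proof.
move=> h0; apply/funext => n.
rewrite /pscomp (@psmul_weighted u v (fun k => psexp h k n)); last first.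
  by move=> s lt_ns; apply: psexp_eq0.
symmetry; transitivity (\sum_(a < n.+1) \sum_(i < n.+1) \sum_(j < n.+1)
    u i * v j * (psexp h i a * psexp h j (n - a)%N)).
  apply: eq_bigr => a _; rewrite -/(pscomp u h a) -/(pscomp v h (n - a)%N).
  rewrite !(@pscomp_wide _ h _ n.+1) ?ltn_ord ?ltnS ?leq_subr // mulr_suml.
  apply: eq_bigr => i _; rewrite mulr_sumr.
  by apply: eq_bigr => j _; rewrite mulrACA.
rewrite exchange_big; apply: eq_bigr => i _.
rewrite exchange_big; apply: eq_bigr => j _.
by rewrite psexpD [in RHS]/psmul mulr_sumr.
Qed.

Lemma pscomp_psone h : pscomp (psone R) h = psone R.
Proof.
apply/funext => n; rewrite /pscomp big_ord_recl /= {1}/psone mul1r.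
by rewrite big1 ?addr0 // => i _; rewrite {1}/psone mul0r.
Qed.

Lemma pscomp_psexp g h k : h 0%N = 0 -> psexp (pscomp g h) k = pscomp (psexp g k) h.
Proof.
move=> h0; elim: k => [|k IH]; first by rewrite pscomp_psone.
by rewrite /psexp !iterS -/(psexp _ k) IH pscompM.
Qed.

(** Linearity in f reduces the claim to f = t^j, that is, to
    [pscomp_psexp]. *)
Lemma pscompA f g h : g 0%N = 0 -> h 0%N = 0 ->
  pscomp f (pscomp g h) = pscomp (pscomp f g) h.
Proof.
move=> g0 h0; apply/funext => n; symmetry.
transitivity (\sum_(k < n.+1) \sum_(j < n.+1) f j * psexp g j k * psexp h k n).
  apply: eq_bigr => k _.
  by rewrite (@pscomp_wide _ g _ n.+1) // mulr_suml.
rewrite exchange_big; apply: eq_bigr => j _.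
by rewrite pscomp_psexp // /pscomp mulr_sumr; apply: eq_bigr => k _; rewrite mulrA.
Qed.

(** The matrix of coefficients of the powers h^k is unitriangular, so f can be
    recovered from f(h(t)) one coefficient at a time. *)
Lemma pscomp_injl f g h : h 0%N = 0 -> h 1%N = 1 ->
  pscomp f h = pscomp g h -> f = g.
Proof.
move=> h0 h1 e; apply/funext => n; elim/ltn_ind: n => n IH.
have := congr1 (fun s => s n) e; rewrite /pscomp !big_ord_recr /=.
rewrite psexp_diag // !mulr1 (eq_bigr (fun i : 'I_n => g i * psexp h i n)); last first.
  by move=> i _; rewrite IH.
exact: addrI.
Qed.

End Substitution.

(** * Change of letter in a Greek ring *)

Section GreekRings.
Variable R : greekRing.
Implicit Types (alpha beta gamma : letter R) (x y : R).

Lemma greek_op_operation alpha : is_greek_operation (greek_op alpha).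
Proof.
have := greek_op_orbit alpha; have [b [[b0 b1 bD] ->]] := greek_orbitP R.
move=> [tau _ <-]; have t0 := letter_val0 tau; split.
- by move=> x; rewrite /op_act /pscomp big_ord1 /op_series b0 mul1r.
- move=> x; rewrite /op_act /pscomp !big_ord_recl big_ord0 /= psexp1 letter_val1.
  by rewrite /psexp /= /psone mulr0 add0r mulr1 addr0 /op_series b1.
- move=> d x y; rewrite /op_act.
  have -> : op_series b (x + y) = psmul (op_series b x) (op_series b y).
    by apply/funext => n; rewrite /op_series bD.
  by rewrite pscompM.
Qed.

Lemma greek_op1 alpha d :
  greek_op alpha d 1 = psone R d + letter_val alpha d.
Proof.
by rewrite -[in RHS](greek_op_letter alpha) /op_letter addrC subrK.
Qed.

(** Changing the letter from alpha to alpha(beta(t)) is substitution of beta: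
    the right-hand side lies in the orbit by [pscompA] and has the right letter,
    and letters determine the elements of the orbit. *)
Lemma greek_op_comp alpha beta gamma : pscomp alpha beta = gamma ->
  greek_op gamma = op_act (greek_op alpha) beta.
Proof.
move=> abE; apply: greek_op_unique; first exact: greek_op_orbit.
  have := greek_op_orbit alpha; have [b [_ ->]] := greek_orbitP R.
  move=> [tau _ <-]; have [t0 b0] := (letter_val0 tau, letter_val0 beta).
  have c0 : pscomp tau beta 0%N = 0 by rewrite /pscomp big_ord1 t0 mul0r.
  have c1 : pscomp tau beta 1%N = 1.
    rewrite /pscomp !big_ord_recl big_ord0 /= psexp1 t0 mul0r add0r addr0.
    by rewrite !letter_val1 mulr1.
  exists (Letter c0 c1) => //; apply/funext => d; apply/funext => x.
  rewrite /op_act /= pscompA //.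
rewrite greek_op_letter op_letter_act ?greek_op_letter //.
by have [] := greek_op_operation alpha.
Qed.

End GreekRings.

(** * The series 1 + x t / (1 - t) and the letter pi *)

Section PfisterSeries.
Variable R : comPzRingType.
Implicit Types (x : R).

Definition geometric_series x : pseries R := fun d => if d is 0%N then 1 else x.

Definition linear_series x : pseries R :=
  fun d => if d is d'.+1 then x *+ (d' == 0%N) else 1.

Let p : pseries R := letterz R pi_letter.

Lemma pscomp_lambda (tau : letter R) : pscomp (letterz R lambda_letter) tau = tau.
Proof.
apply/funext => -[|n]; first by rewrite /pscomp big_ord1 mul0r letter_val0.
rewrite pscompS ?letter_val1 // /pscomp_high big1 ?addr0 // => k _.
by rewrite /= /letterz_val /= mul0r.
Qed.

(** This is the identity (1 + t) p^(k+1) = t p^k. *)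
Lemma pi_recurrence k n : psexp p k.+1 n.+1 + psexp p k.+1 n = psexp p k n.
Proof.
have p0 : p 0%N = 0 by [].
have p1 : p 1%N = 1 by apply: letter_val1.
have pS i : p i.+2 = - p i.+1 by rewrite /p /= /letterz_val /= exprS mulN1r rmorphN.
case: n => [|n].
  rewrite addrC psexp_eq0 // add0r psexpS !big_ord_recl big_ord0 /= p0 p1.
  by rewrite mul0r add0r addr0 mul1r.
(* p_(i+2) = - p_(i+1): shifted by one, the two sums cancel from degree 2 on. *)
rewrite psexpS 2!big_ord_recl (psexpS p k n.+1).
rewrite [X in _ + X = _]big_ord_recl /= p0 p1 !mul0r !add0r mul1r.
rewrite subn1 /= -addrA -big_split big1 ?addr0 //= => i _.
by rewrite pS mulNr addNr.
Qed.

(** This is p + p^2 + p^3 + ... = p / (1 - p) = t, obtained by summing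
    [pi_recurrence] over k: the sum on the right telescopes against the
    contribution of degree n on the left and leaves only p^0 = 1. *)
Lemma sum_pi_powers n : \sum_(k < n.+1) psexp p k.+1 n.+1 = (n == 0%N)%:R.
Proof.
have p0 : p 0%N = 0 by [].
have : \sum_(k < n.+1) psexp p k.+1 n.+1 + \sum_(k < n.+1) psexp p k.+1 n =
       \sum_(k < n.+1) psexp p k n.
  by rewrite -big_split; apply: eq_bigr => k _; apply: pi_recurrence.
rewrite [X in _ + X]big_ord_recr /= psexp_eq0 // addr0 [RHS]big_ord_recl.
exact: addIr.
Qed.

Lemma geometric_comp_pi x : pscomp (geometric_series x) p = linear_series x.
Proof.
apply/funext => -[|n].
  by rewrite /pscomp big_ord1 mul1r.
rewrite /pscomp big_ord_recl /= {1}/psexp /= mulr0 add0r -mulr_sumr.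
by rewrite sum_pi_powers mulr_natr.
Qed.

End PfisterSeries.

(** * Pfister elements *)

Section Pfister.
Variable R : greekRing.
Implicit Types a x : R.

Local Notation lam := (zgreek_op lambda_letter).

Lemma zgreek_op_operation alpha : is_greek_operation (@zgreek_op R alpha).
Proof. exact: greek_op_operation. Qed.

Lemma series_degree1P (f : pseries R) x : f 0%N = 1 -> f 1%N = x ->
  psdeg_le f 1 <-> f = linear_series x.
Proof.
move=> f0 f1; split=> [f_le1|-> [|[|d]] //].
by apply/funext => -[|[|d]] //=; rewrite ?f_le1.
Qed.

Lemma lambda_pfisterP x :
  (forall d, (1 <= d)%N -> lam d x = x) <-> op_series lam x = geometric_series x.
Proof.
have [lam0 _ _] := zgreek_op_operation lambda_letter.
split=> [lamx|e [|d] // _]; last exact: (congr1 (fun f => f d.+1) e).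
by apply/funext => -[|d]; [apply: lam0 | apply: lamx].
Qed.

Lemma lambda_pi_dimP x :
  (forall d, (1 <= d)%N -> lam d x = x) <-> greek_dim_le pi_letter x 1.
Proof.
rewrite lambda_pfisterP /greek_dim_le.
have [pi0 pi1 _] := zgreek_op_operation pi_letter.
rewrite (series_degree1P (pi0 x) (pi1 x)) -geometric_comp_pi.
have -> : op_series (zgreek_op pi_letter) x =
          pscomp (op_series lam x) (letterz R pi_letter).
  by rewrite /zgreek_op (greek_op_comp (pscomp_lambda _)).
split=> [-> //|]; apply: pscomp_injl; [exact: letter_val0|exact: letter_val1].
Qed.

(** These are the coefficients of lambda_t(a) lambda_t(1 - a) = 1 + t in the
    degrees at least 2. *)
Lemma lambda_one_sub a d :
  \sum_(k < d.+3) lam k a * lam (d.+2 - k)%N (1 - a) = 0.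
Proof.
have [_ _ lamD] := zgreek_op_operation lambda_letter.
rewrite -lamD addrC subrK /zgreek_op greek_op1.
by rewrite /psone /= /letterz_val /= add0r.
Qed.

(** Here lambda_t(1 - a)(1 + a t) = 1 + t, whence
    lambda^(d+1)(1 - a) = - a lambda^d(1 - a) for positive d; and 1 - a is fixed
    by multiplication by - a, because a ^ 2 = 1. *)
Lemma lambda_dim1_one_sub a : (forall d, (1 < d)%N -> lam d a = 0) ->
  a ^+ 2 = 1 -> forall d, (1 <= d)%N -> lam d (1 - a) = 1 - a.
Proof.
move=> a_le1 a2; have [lam0 lam1 _] := zgreek_op_operation lambda_letter.
elim=> // -[_ _|d IH _]; first exact: lam1.
have := lambda_one_sub a d; rewrite 2!big_ord_recl big1 => [|i _]; last first.
  by rewrite a_le1 ?mul0r.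
rewrite /= /bump /= !addn0 subn0 subn1 addr0 lam0 lam1 mul1r IH //.
move=> /eqP; rewrite addr_eq0 => /eqP ->.
by rewrite mulrBr mulr1 -expr2 a2 opprB.
Qed.

(** By induction only the terms of index 0, 1 and d of the degree d coefficient
    of lambda_t(1 - x) lambda_t(x) survive; the first two, x and (1 - x) x,
    cancel because x ^ 2 = 2 x. *)
Lemma lambda_pfister_one_sub x : x ^+ 2 = 2%:R * x ->
  (forall d, (1 <= d)%N -> lam d x = x) ->
  forall d, (1 < d)%N -> lam d (1 - x) = 0.
Proof.
move=> x2 lamx; have [lam0 lam1 _] := zgreek_op_operation lambda_letter.
elim/ltn_ind=> -[|[|d]] // IH _.
have := lambda_one_sub (1 - x) d; rewrite subKr big_ord_recr 2!big_ord_recl.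
rewrite big1 => [|i _]; last first.
  by rewrite IH ?mul0r //= /bump /= !add1n !ltnS.
rewrite /= /bump /= !addn0 subn0 subn1 subnn addr0 !lam0 lam1 !lamx //.
rewrite mul1r mulr1 mulrBl mul1r -expr2 x2 mulr_natl mulr2n opprD.
by rewrite addNKr addrN add0r.
Qed.

End Pfister.

Theorem proposition1p1p37 (R : greekRing) :
  (forall x : R,
     pfister x <-> x ^+ 2 = 2%:R * x /\ greek_dim_le pi_letter x 1)
  /\
  ((1 : R) <> 0 ->
   forall x : R,
     pfister x <->
     exists a : R,
       [/\ greek_dim_eq lambda_letter a 1, a ^+ 2 = 1 & x = 1 - a]).
Proof.
split=> [x|one_neq0 x]; first by rewrite /pfister lambda_pi_dimP.
split=> [[x2 lamx]|[a [[_ a_le1] a2 ->]]]; last first.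
  split; last exact: lambda_dim1_one_sub.
  by rewrite sqrrB expr1n mul1r a2 mulr_natl mulrnBl addrAC.
have a2 : (1 - x) ^+ 2 = 1.
  by rewrite sqrrB expr1n mul1r x2 mulr_natl subrK.
exists (1 - x); split; rewrite ?subKr //; split; last exact: lambda_pfister_one_sub.
have [_ lam1 _] := zgreek_op_operation R lambda_letter.
rewrite /op_series lam1 => a0.
by apply: one_neq0; rewrite -a2 a0 expr0n.
Qed.
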